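(* Let $G=(V,E)$ be a finite graph carrying a $q$-spin system with pairwise interactions, with reference spin $\sigma_q$. For every such graph $G$, every $\Lambda\subseteq V$, every configuration $\sigma_\Lambda$ on $\Lambda$, every vertex $v\in V$ and all $\sigma_v$, $$R_G^{\sigma_\Lambda}(v=\sigma_v)=\mathbb{R}_{T_{CD}}^{\sigma_\Lambda}(v=\sigma_v),$$ where $R_G^{\sigma_\Lambda}(v=\sigma_v)=p_G^{\sigma_\Lambda}(v=\sigma_v)/p_G^{\sigma_\Lambda}(v=\sigma_q)$, $T_{CD}$ is the correlation decay tree of $G$ rooted at $v$, and $\mathbb{R}_{T_{CD}}^{\sigma_\Lambda}(v=\sigma_v)$ is the ratio (with respect to the reference spin $\sigma_q$) of the probability that the root $v$ of $T_{CD}$ has spin $\sigma_v$, when the computation is performed by the tree recursion with coupling lines. The actual probabilities can be computed from the ratios by normalizing them so that the probabilities sum to one.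
   Context: **Spin system.** $X=\{\sigma_1,\dots,\sigma_q\}$ is a finite set of spins and $\sigma_q$ is a fixed reference spin. $G=(V,E)$ is a finite graph, with edge interactions $\Phi_{i,j}(x_i,x_j)=\Phi_{j,i}(x_j,x_i)\ge 0$ for $\{i,j\}\in E$ and vertex potentials $\phi_i(x_i)\ge 0$. The Gibbs measure gives $\vec x\in X^V$ probability proportional to $\prod_{\{i,j\}\in E}\Phi_{i,j}(x_i,x_j)\prod_{i\in V}\phi_i(x_i)$. For $\Lambda\subseteq V$ (frozen vertices) and $\sigma_\Lambda\in X^\Lambda$, $p_G^{\sigma_\Lambda}(v=\sigma)$ is the marginal probability that $v$ has spin $\sigma$ when the vertices of $\Lambda$ are frozen to $\sigma_\Lambda$, with weights given by the same product. **CD tree.** Fix a total order (labeling) on $E$. The nodes of $T_{CD}$ (rooted at $v$) are: all self-avoiding walks $w_0=v,w_1,\dots,w_k$ in $G$ ($k\ge 0$), together with all walks $w_0=v,\dots,w_k,w_{k+1}$ such that $w_0,\dots,w_k$ is self-avoiding and $w_{k+1}=w_j$ for some $j\le k-2$ with $j\ge 0$ (these are the vertices that close a cycle; they are leaves). The parent of a walk is the walk with its last step deleted. Each node is a copy of the last vertex of its walk and inherits that vertex's potential; tree edges inherit the interactions of the corresponding edges of $G$. Boundary conditions: - a node that is a copy of a vertex of $\Lambda$ is frozen to the value prescribed by $\sigma_\Lambda$, and the subtree below it is pruned; - a cycle-closing node $(w_0,\dots,w_k,w_{k+1}=w_j)$ whose end vertex is not in $\Lambda$ is frozen to $\sigma_q$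 if the closing edge $\{w_k,w_j\}$ is larger in the order than the edge $\{w_j,w_{j+1}\}$ that begins the cycle; if it is smaller, the node is constrained to take the same value as its ancestor $(w_0,\dots,w_j)$, which is recorded by a *coupling line* joining the two. The ancestor is the top endpoint and the cycle-closing leaf is the lower endpoint of the coupling line. **Recursion on a tree with coupling lines.** For a node $w$ let $B(w)$ be the set of lower endpoints of coupling lines whose top endpoint is $w$. For a partial assignment $\eta$ of spins to nodes (the currently frozen nodes), define $R_w^{\eta}(s)$ for $s\in X$ as follows. If $w$ is frozen by $\eta$, then $R_w^\eta(s)=1$ if $s=\eta(w)$ and $0$ otherwise. If $w$ is not frozen, let $\eta_s$ be $\eta$ extended by freezing every node of $B(w)$ to $s$, and set $$R_w^{\eta}(s)=\frac{\phi_w(s)}{\phi_w(\sigma_q)}\prod_{u\text{ child of }w}\frac{\sum_{l=1}^q\Phi_{w,u}(s,\sigma_l)\,R_u^{\eta_s}(\sigma_l)}{\sum_{l=1}^q\Phi_{w,u}(\sigma_q,\sigma_l)\,R_u^{\eta_s}(\sigma_l)}$$ (empty product $=1$). Then $\mathbb{R}_{T_{CD}}^{\sigma_\Lambda}(v=\sigma_v)$ is $R_{\rm root}^{\eta}(\sigma_v)$, where $\eta$ consists of the nodes frozen by $\sigma_\Lambda$ and those frozen to $\sigma_q$ by the construction.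
   Formalization: Weights may be zero, so ratios may divide by zero; the formal statement assumes that the conditional Gibbs measure exists, that p_G(v=σ_q)≠0 (for the ratio identity only), and that no denominator in the tree recursion vanishes. *)

(* Defs.v *)
From HB Require Import structures.
From mathcomp Require Import all_boot all_order all_algebra.

Set Implicit Arguments.
Unset Strict Implicit.
Unset Printing Implicit Defensive.

Import Order.TTheory GRing.Theory Num.Theory.
Local Open Scope ring_scope.

Record spin_system (R : realFieldType) (X V : finType) := SpinSystem {
  adj : rel V;
  adj_sym : symmetric adj;
  adj_irr : irreflexive adj;
  inter : V -> V -> X -> X -> R;
  inter_sym : forall i j, adj i j -> forall a b, inter i j a b = inter j i b a;
  inter_ge0 : forall i j, adj i j -> forall a b, 0 <= inter i j a b;
  pot : V -> X -> R;
  pot_ge0 : forall i a, 0 <= pot i a }.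

Section SpinSystem.

Variables (R : realFieldType) (X V : finType) (G : spin_system R X V).

Definition edges : {set {set V}} :=
  [set [set p.1; p.2] | p : V * V & adj G p.1 p.2].

Definition edge_order (le : rel {set V}) : Prop :=
  [/\ {in edges &, antisymmetric le},
      {in edges & &, transitive le} &
      {in edges &, total le}].

(* The condition on [enum_rank] selects one orientation of each edge; by
   [inter_sym] the product does not depend on the orientation. *)
Definition weight (x : {ffun V -> X}) : R :=
  (\prod_(p : V * V | adj G p.1 p.2 && (enum_rank p.1 < enum_rank p.2)%N)
     inter G p.1 p.2 (x p.1) (x p.2)) *
  \prod_(i : V) pot G i (x i).

(* A configuration on [L] is given by a total function [sL], of which only
   the values on [L] are ever used. *)
Definition agrees (L : {set V}) (sL : V -> X) (x : {ffun V -> X}) : bool :=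
  [forall i in L, x i == sL i].

Definition partition_function (L : {set V}) (sL : V -> X) : R :=
  \sum_(x : {ffun V -> X} | agrees L sL x) weight x.

Definition marginal (L : {set V}) (sL : V -> X) (v : V) (s : X) : R :=
  (\sum_(x : {ffun V -> X} | agrees L sL x && (x v == s)) weight x)
    / partition_function L sL.

Definition graph_ratio (sq : X) (L : {set V}) (sL : V -> X) (v : V) (s : X) :=
  marginal L sL v s / marginal L sL v sq.

End SpinSystem.

Section CDTree.

Variables (R : realFieldType) (X V : finType) (sq : X).
Variables (G : spin_system R X V) (le : rel {set V}).
Variables (L : {set V}) (sL : V -> X) (v : V).

(* A node of the tree is the sequence w_0 = v, ..., w_k of vertices of its
   walk; [endv w] is the vertex of which it is a copy. *)
Implicit Types w u : seq V.

Definition endv w : V := last v w.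
Definition parent w : seq V := take (size w).-1 w.

Definition saw w : bool :=
  if w is x :: p then [&& x == v, path (adj G) x p & uniq w] else false.

(* The index j at which the cycle closed by [u] begins.  It is unique, since
   the parent of a cycle-closing node is self-avoiding. *)
Definition cycle_start u : nat := index (endv u) u.

(* For u = w_0, ..., w_k, w_(k+1), of size k + 2, the last conjunct says
   j <= k - 2 (and is false if [u] is itself self-avoiding). *)
Definition cycle_closing u : bool :=
  [&& saw (parent u), adj G (endv (parent u)) (endv u)
    & ((cycle_start u).+3 < size u)%N].

Definition closing_edge u : {set V} := [set endv (parent u); endv u].
Definition beginning_edge u : {set V} :=
  [set nth v u (cycle_start u); nth v u (cycle_start u).+1].
Definition ancestor u : seq V := take (cycle_start u).+1 u.

(* The last condition prunes the tree below the copies of vertices of L. *)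
Definition cd_node w : bool :=
  (saw w || cycle_closing w) && all (fun x => x \notin L) (parent w).

Definition edge_lt (A B : {set V}) : bool := (A != B) && le A B.

Definition assignment := seq V -> option X.

Definition cd_boundary : assignment := fun u =>
  if endv u \in L then Some (sL (endv u))
  else if cycle_closing u && edge_lt (beginning_edge u) (closing_edge u)
  then Some sq
  else None.

(* [coupled w u]: a coupling line joins the top endpoint [w] to the lower
   endpoint [u], that is, u \in B(w). *)
Definition coupled w u : bool :=
  [&& cd_node u, cycle_closing u, endv u \notin L,
      edge_lt (closing_edge u) (beginning_edge u) & ancestor u == w].

Definition freeze (eta : assignment) w (s : X) : assignment := fun u =>
  if coupled w u then Some s else eta u.

(* [n] bounds the depth of the recursion. *)
Fixpoint ratio_rec (n : nat) (eta : assignment) w (s : X) : R :=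
  if eta w is Some t then (s == t)%:R
  else if n is n'.+1 then
    pot G (endv w) s / pot G (endv w) sq *
    \prod_(x : V | cd_node (rcons w x))
      ((\sum_(l : X) inter G (endv w) x s l *
          ratio_rec n' (freeze eta w s) (rcons w x) l) /
       (\sum_(l : X) inter G (endv w) x sq l *
          ratio_rec n' (freeze eta w s) (rcons w x) l))
  else 0.

(* A node has at most #|V| + 1 vertices, so this bound is never reached: see
   [tree_ratioE]. *)
Definition tree_ratio (eta : assignment) w (s : X) : R :=
  ratio_rec (#|V|.+2 - size w) eta w s.

Definition child_sum (eta : assignment) w (s : X) (x : V) (a : X) : R :=
  \sum_(l : X) inter G (endv w) x a l *
    tree_ratio (freeze eta w s) (rcons w x) l.

(* The evaluation of [tree_ratio eta w s] never divides by zero.  As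
   interactions and potentials may vanish, this has to be said: the field
   division is total, with a / 0 = 0. *)
Inductive ratio_defined : assignment -> seq V -> X -> Prop :=
| RatioFrozen eta w s t : eta w = Some t -> ratio_defined eta w s
| RatioFree eta w s :
    eta w = None ->
    pot G (endv w) sq != 0 ->
    (forall x, cd_node (rcons w x) -> child_sum eta w s x sq != 0) ->
    (forall x, cd_node (rcons w x) ->
       forall l, ratio_defined (freeze eta w s) (rcons w x) l) ->
    ratio_defined eta w s.

Definition cd_ratio (s : X) : R := tree_ratio cd_boundary [:: v] s.

Definition cd_ratio_defined (s : X) : Prop :=
  ratio_defined cd_boundary [:: v] s.

Lemma parent_rcons w x : parent (rcons w x) = w.
Proof. by rewrite /parent size_rcons /= -cats1 take_size_cat. Qed.

Lemma saw_size w : saw w -> (size w <= #|V|)%N.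
Proof. by case: w => // x p /and3P[_ _ /card_uniqP <-]; apply: max_card. Qed.

Lemma cd_node_size w : cd_node w -> (size w <= #|V|.+1)%N.
Proof.
case/andP=> /orP[/saw_size/leqW // | /and3P[/saw_size + _ _] _].
by rewrite /parent size_take; case: (size w) => // n; rewrite ltnSn.
Qed.

Lemma tree_ratio_frozen eta w s t :
  eta w = Some t -> tree_ratio eta w s = (s == t)%:R.
Proof. by rewrite /tree_ratio => h; case: (_ - _)%N => [|n] /=; rewrite h. Qed.

Lemma tree_ratioE eta w s :
  cd_node w -> eta w = None ->
  tree_ratio eta w s =
    pot G (endv w) s / pot G (endv w) sq *
    \prod_(x : V | cd_node (rcons w x))
      (child_sum eta w s x s / child_sum eta w s x sq).
Proof.
move=> /cd_node_size hw h; rewrite /tree_ratio subSn //= h; congr (_ * _).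
by apply: eq_bigr => x _; rewrite /child_sum /tree_ratio size_rcons subSS.
Qed.

Lemma cd_node_root : cd_node [:: v].
Proof. by rewrite /cd_node /saw /= eqxx. Qed.

Lemma cd_node_adj w x : w != [::] -> cd_node (rcons w x) -> adj G (endv w) x.
Proof.
case: w => // y p _ /andP[/orP[|/and3P[_ + _] _]].
  by rewrite /saw /= rcons_path => /and3P[_ /andP[]].
by rewrite parent_rcons /endv last_rcons.
Qed.

(* The recursion is defined for strictly positive systems. *)
Lemma positive_ratio_defined :
  (forall i j a b, adj G i j -> 0 < inter G i j a b) ->
  (forall i a, 0 < pot G i a) ->
  forall s, cd_ratio_defined s.
Proof.
move=> Ppos ppos s; rewrite /cd_ratio_defined.
have main n : forall eta w, w != [::] -> cd_node w ->
    (#|V|.+2 - size w <= n)%N ->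
  [/\ forall s, ratio_defined eta w s, forall s, 0 <= tree_ratio eta w s
    & exists s, 0 < tree_ratio eta w s].
  elim: n => [|n IH] eta w w0 nw hn.
    move: hn; rewrite leqn0 subn_eq0 => /leq_trans /(_ (cd_node_size nw)).
    by rewrite ltnn.
  case h: (eta w) => [t|].
    split=> [s'|s'|]; first exact: RatioFrozen h.
      by rewrite (tree_ratio_frozen _ h) ler0n.
    by exists t; rewrite (tree_ratio_frozen _ h) eqxx ltr01.
  have IHx s' x : cd_node (rcons w x) ->
    [/\ forall l, ratio_defined (freeze eta w s') (rcons w x) l,
        forall l, 0 <= tree_ratio (freeze eta w s') (rcons w x) l
      & exists l, 0 < tree_ratio (freeze eta w s') (rcons w x) l].
    move=> nx; apply: IH => //; first by case: (w).
    by rewrite size_rcons subSS -ltnS -subSn ?cd_node_size.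
  have cpos s' x a : cd_node (rcons w x) -> 0 < child_sum eta w s' x a.
    move=> nx; have [_ ge0 [l lpos]] := IHx s' x nx.
    have ax := cd_node_adj w0 nx.
    rewrite /child_sum (bigD1 l) //= ltr_pwDl ?mulr_gt0 ?Ppos //.
    by apply: sumr_ge0 => l' _; rewrite mulr_ge0 // ltW ?Ppos.
  have rpos s' : 0 < tree_ratio eta w s'.
    rewrite tree_ratioE // mulr_gt0 ?divr_gt0 //.
    by apply: prodr_gt0 => x nx; rewrite divr_gt0 ?cpos.
  split=> [s'|s'|]; last by exists sq.
    apply: RatioFree => // [|x nx|x nx]; first by rewrite gt_eqF.
      by rewrite gt_eqF ?cpos.
    by have [] := IHx s' x nx.
  exact: ltW.
by have [] := main _ cd_boundary [:: v] isT cd_node_root (leqnn _).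
Qed.

End CDTree.

(* Main.v *)
Require Import Defs.
From HB Require Import structures.
From mathcomp Require Import all_boot all_order all_algebra perm ring.

Set Implicit Arguments.
Unset Strict Implicit.
Unset Printing Implicit Defensive.

Import Order.TTheory GRing.Theory Num.Theory.
Local Open Scope ring_scope.

(* Vertices are deleted one after the other along a self-avoiding walk from [v].
   Deleting [y] with spin [s] splits it into one leaf per remaining neighbour,
   frozen to [s], which amounts to changing the vertex potentials of these
   neighbours.  The ratio of the weights for [s] and [sq] telescopes when the
   leaves change from [sq] to [s] one at a time, in edge order: the step at [x]
   compares two values of a pendant vertex at [x], so it is governed by the
   vector of weights at [x] in a smaller graph, which by induction is
   proportional to the ratios of the subtree at [x].  The edge order and the
   coupling lines encode which copies of [y] have already changed.  Stating
   proportionality instead of equality of ratios avoids divisions, so vanishing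
   interactions cause no trouble. *)

(** The one-step identity is asked only at prefixes of [r]: in a sorted list these are the elements
    preceding [x]. *)
Lemma telescope_seq (R : comPzRingType) (T : Type) (H : seq T -> R) (q : T -> R)
    (r : seq T) :
  (forall r1 x r2, r = r1 ++ x :: r2 -> H (rcons r1 x) = H r1 * q x) ->
  H r = H [::] * \prod_(x <- r) q x.
Proof.
elim/last_ind: r => [|r x IH] Hq; first by rewrite big_nil mulr1.
rewrite (Hq r x [::]) ?cats1 // IH ?big_rcons /= ?mulrA //.
by move=> r1 y r2 e; apply: (Hq r1 y (rcons r2 x)); rewrite e rcons_cat.
Qed.

(** * Weights on the graph with a set [S] of vertices deleted *)

Section FieldWeights.

Variables (R : realFieldType) (X V : finType) (G : spin_system R X V).
Implicit Types (S : {set V}) (g : V -> X -> R) (x : {ffun V -> X}).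

Definition edge_weight S x : R :=
  \prod_(p : V * V | [&& adj G p.1 p.2, (enum_rank p.1 < enum_rank p.2)%N,
                         p.1 \notin S & p.2 \notin S])
     inter G p.1 p.2 (x p.1) (x p.2).

Definition field_weight S g x : R :=
  edge_weight S x * \prod_(y | y \notin S) g y (x y).

(** Configurations stay total on [V], so each deleted vertex contributes a spurious factor
    [#|X|]. *)
Definition field_sum S g : R := \sum_x field_weight S g x.

Definition pinned_sum S g y a : R :=
  \sum_(x : {ffun V -> X} | x y == a) field_weight S g x.

Lemma edge_weight_setU1 S y x : y \notin S ->
  edge_weight S x =
    \prod_(z | (z \notin y |: S) && adj G y z) inter G y z (x y) (x z) *
    edge_weight (y |: S) x.
Proof.
move=> yS; rewrite /edge_weight (bigID (fun p => (p.1 == y) || (p.2 == y))) /=.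
congr (_ * _); last first.
  apply: eq_bigl => p; rewrite !inE.
  by case: (p.1 == y); case: (p.2 == y); rewrite ?andbF ?andbT.
(* The edges at [y] are listed as [(y, z)] or [(z, y)] according to the rank of [z]. *)
rewrite (bigID (fun p => p.1 == y)) /=.
rewrite [RHS](bigID (fun z => (enum_rank y < enum_rank z)%N)) /=.
have irr z : adj G y z -> z != y.
  by apply: contraTneq => ->; rewrite adj_irr.
congr (_ * _).
  rewrite (reindex_onto (fun z => (y, z)) snd) /=; last first.
    by move=> [a b] /= /andP[_ /eqP ->].
  apply: eq_bigl => z; rewrite !inE !eqxx /= yS !andbT.
  case ayz: (adj G y z); rewrite ?andbF //= ?andbT (negbTE (irr _ ayz)) /=.
  by rewrite andbC.
rewrite (reindex_onto (fun z => (z, y)) fst) /=; last first.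
  move=> [a b] /= /andP[/andP[_ /orP[->|/eqP ->]]] //.
rewrite [RHS](eq_bigr (fun z => inter G z y (x z) (x y))); last first.
  by move=> z /andP[/andP[_ ayz] _]; rewrite (inter_sym ayz).
apply: eq_bigl => z; rewrite !inE !eqxx /= yS orbT !andbT (adj_sym G z y).
case ayz: (adj G y z); rewrite ?andbF //= (negbTE (irr _ ayz)) /= !andbT.
rewrite andbC -leqNgt ltn_neqAle; congr (_ && _).
by rewrite -[_ == _ :> nat]/(enum_rank z == enum_rank y)
  (inj_eq enum_rank_inj) (negbTE (irr _ ayz)).
Qed.

Lemma eq_field_sum S g1 g2 :
  (forall z, z \notin S -> g1 z =1 g2 z) ->
  field_sum S g1 = field_sum S g2.
Proof.
move=> e; apply: eq_bigr => x _; congr (_ * _).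
by apply: eq_bigr => z zS; apply: e.
Qed.

Lemma field_sum_pinned S g y : field_sum S g = \sum_a pinned_sum S g y a.
Proof. by rewrite /field_sum (partition_big (fun x => x y) predT). Qed.

Lemma pinned_sum_factor S g1 g2 y h a : y \notin S ->
  (forall z, z \notin S -> z != y -> g1 z =1 g2 z) ->
  (forall b, g1 y b = h b * g2 y b) ->
  pinned_sum S g1 y a = h a * pinned_sum S g2 y a.
Proof.
move=> yS e ey; rewrite /pinned_sum big_distrr /=.
apply: eq_bigr => x /eqP xy; rewrite /field_weight [RHS]mulrCA.
congr (_ * _); rewrite (bigD1 y) //= [in RHS](bigD1 y) //= ey xy mulrA.
by congr (_ * _); apply: eq_bigr => z /andP[zS zy]; apply: e.
Qed.

(** Exchanging two spins at [y] maps one fibre onto another, so all [#|X|] fibres have the same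
    sum. *)
Lemma sum_pinned_free (y : V) (f : {ffun V -> X} -> R) (a : X) :
  (forall x1 x2, (forall z, z != y -> x1 z = x2 z) -> f x1 = f x2) ->
  \sum_(x : {ffun V -> X} | x y == a) f x = #|X|%:R^-1 * \sum_x f x.
Proof.
move=> fy; apply: (@mulfI _ #|X|%:R).
  by rewrite pnatr_eq0 -lt0n; apply/card_gt0P; exists a.
rewrite mulVKf; last first.
  by rewrite pnatr_eq0 -lt0n; apply/card_gt0P; exists a.
rewrite [RHS](partition_big (fun x : {ffun V -> X} => x y) predT) //=.
rewrite mulr_natl -sumr_const; apply: eq_big => // b _.
pose h (x : {ffun V -> X}) := [ffun z => if z == y then tperm a b (x z) else x z].
have hK : involutive h.
  by move=> x; apply/ffunP => z; rewrite !ffunE; case: eqP => // _; rewrite tpermK.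
rewrite (reindex_inj (inv_inj hK)) /=; apply: eq_big => x.
  by rewrite ffunE eqxx (canF_eq (@tpermK _ a b)) tpermL.
by move=> _; apply: fy => z /negbTE zy; rewrite ffunE zy.
Qed.

(** [b z] is the spin of the leaf copy of [y] hanging at [z]; it may differ from neighbour to
    neighbour. *)
Definition couple g y (b : V -> X) : V -> X -> R :=
  fun z a => g z a * (if adj G y z then inter G y z (b z) a else 1).

(** Once the spin of [y] is fixed, its edges act as potentials on its neighbours and nothing else
    depends on [y]; [#|X|%:R^-1] undoes the spurious sum over its spin. *)
Lemma pinned_sum_couple S g y a : y \notin S ->
  pinned_sum S g y a =
    #|X|%:R^-1 * g y a * field_sum (y |: S) (couple g y (fun=> a)).
Proof.
move=> yS; rewrite mulrAC -(@sum_pinned_free y _ a) => [|x1 x2 e]; last first.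
  congr (_ * _); apply: eq_bigr => z; last first.
    by rewrite !inE negb_or => /andP[zy _]; rewrite /couple e.
  by rewrite !inE !negb_or => /and4P[_ _ /andP[p1 _] /andP[p2 _]]; rewrite !e.
rewrite /pinned_sum big_distrl /=; apply: eq_bigr => x /eqP xy.
rewrite /field_weight (edge_weight_setU1 _ yS) xy.
rewrite [\prod_(z | z \notin S) _](bigD1 y) //= xy.
rewrite [\prod_(z | z \notin y |: S) couple _ _ _ _ _]big_split /= -big_mkcondr /=.
have e z : (z \notin y |: S) = (z \notin S) && (z != y).
  by rewrite !inE negb_or andbC.
rewrite -(eq_bigl _ _ e).
rewrite [RHS]mulrC [LHS]mulrCA; congr (_ * _).
by rewrite [RHS]mulrA [RHS]mulrC mulrA.
Qed.

End FieldWeights.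

Section CDTreeRatio.

Variables (R : realFieldType) (X V : finType) (sq : X).
Variables (G : spin_system R X V) (le : rel {set V}).
Hypothesis le_order : edge_order G le.
Variables (L : {set V}) (sL : V -> X) (v : V).
Implicit Types (w u p : seq V) (t : V -> X) (eta : assignment X V).

Local Notation cd_node := (cd_node G L v).
Local Notation saw := (saw G v).
Local Notation cycle_closing := (cycle_closing G v).
Local Notation endv := (endv v).
Local Notation cycle_start := (cycle_start v).
Local Notation freeze := (freeze G le L v).
Local Notation child_sum := (child_sum sq G le L v).
Local Notation tree_ratio := (tree_ratio sq G le L v).
Local Notation ratio_defined := (ratio_defined sq G le L v).
Local Notation edge_lt := (edge_lt le).

(** * The edge order, walks and cycle-closing nodes *)

Lemma edge_set2 x y : adj G x y -> [set x; y] \in edges G.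
Proof. by move=> xy; apply/imsetP; exists (x, y); rewrite ?inE. Qed.

Lemma set2_inj (x : V) : injective (fun y => [set x; y]).
Proof.
move=> y z /setP e; move: (e z) (e y); rewrite !inE !eqxx !orbT.
by case: eqVneq => [->|_ /eqP-> //] _ /esym; rewrite orbb => /eqP.
Qed.

Lemma edge_lt_asym A B : A \in edges G -> B \in edges G ->
  edge_lt A B -> edge_lt B A = false.
Proof.
move=> eA eB /andP[nAB lAB]; apply/negP => /andP[_ lBA].
have [le_anti _ _] := le_order.
by case/eqP: nAB; apply: le_anti; rewrite ?lAB.
Qed.

Lemma edge_lt_total A B : A \in edges G -> B \in edges G -> A != B ->
  edge_lt A B || edge_lt B A.
Proof.
move=> eA eB nAB; have [_ _ le_total] := le_order.
by rewrite /edge_lt nAB eq_sym nAB le_total.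
Qed.

Lemma endv_rcons w x : endv (rcons w x) = x.
Proof. exact: last_rcons. Qed.

Lemma saw_uniq w : saw w -> uniq w.
Proof. by case: w => // x p /and3P[]. Qed.

Lemma saw_adj w i : saw w -> (i.+1 < size w)%N ->
  adj G (nth v w i) (nth v w i.+1).
Proof. by case: w => // x p /and3P[_ /(pathP v) ap _]; apply: ap. Qed.

Lemma saw_rcons w x : w != [::] ->
  saw (rcons w x) = [&& saw w, adj G (endv w) x & x \notin w].
Proof.
case: w => // y p _; rewrite rcons_cons /Defs.saw.
rewrite -[y :: rcons p x]rcons_cons rcons_uniq rcons_path /Defs.endv /=.
by case: (y == v); case: (path _ _ _); case: (adj _ _ _); rewrite ?andbF //= andbC.
Qed.

Lemma saw_not_cycle_closing w : saw w -> cycle_closing w = false.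
Proof.
case/lastP: w => // p x /saw_uniq; rewrite rcons_uniq => /andP[xp _].
apply/negP => /and3P[_ _]; rewrite /cycle_start endv_rcons -cats1 index_cat.
by rewrite (negbTE xp) /= eqxx addn0 size_cat /= addn1 ltnS ltnNge leqW.
Qed.

(** The edge from [z] to this vertex begins any cycle closed at [z]. At the last vertex of [w] the
    value is the meaningless default [v], hence the restrictions to [z \in parent w]. *)
Definition next_vertex w z : V := nth v w (index z w).+1.

Lemma next_vertex_rcons w x z : z \in parent w ->
  next_vertex (rcons w x) z = next_vertex w z.
Proof.
case/lastP: w => // p y; rewrite parent_rcons => zp.
have zpy : z \in rcons p y by rewrite mem_rcons inE zp orbT.
rewrite /next_vertex -[rcons (rcons p y) x]cats1 index_cat zpy nth_cat.
rewrite -cats1 index_cat zp size_cat addn1 ltnS.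
by move: zp; rewrite -index_mem => ->.
Qed.

Lemma next_vertex_last p y x : y \notin p ->
  next_vertex (rcons (rcons p y) x) y = x.
Proof.
move=> yp; rewrite /next_vertex -!cats1 -catA index_cat (negbTE yp) /= eqxx.
by rewrite addn0 nth_cat ltnNge leqW //= subSnn.
Qed.

Lemma beginning_edge_rcons w z : z \in parent w ->
  beginning_edge v (rcons w z) = [set z; next_vertex w z].
Proof.
move=> zw; rewrite -(next_vertex_rcons z zw) /beginning_edge /cycle_start.
rewrite endv_rcons nth_index // mem_rcons inE eqxx //.
Qed.

Lemma closing_edge_rcons w z : closing_edge v (rcons w z) = [set endv w; z].
Proof. by rewrite /closing_edge parent_rcons endv_rcons. Qed.

Lemma cycle_start_rcons w z : z \in w -> cycle_start (rcons w z) = index z w.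
Proof. by move=> zw; rewrite /cycle_start endv_rcons -cats1 index_cat zw. Qed.

(** The bound [j <= k - 2] excludes just the last vertex and its predecessor, the one vertex
    followed by [endv w]. *)
Lemma cycle_closing_rcons w z : saw w -> z \in w ->
  cycle_closing (rcons w z) =
    [&& z \in parent w, adj G (endv w) z & endv w != next_vertex w z].
Proof.
move=> sw zw; rewrite /Defs.cycle_closing parent_rcons endv_rcons sw /=.
rewrite cycle_start_rcons // size_rcons ltnS.
case/lastP: w sw zw => // p y /saw_uniq uw zw.
rewrite parent_rcons endv_rcons /next_vertex size_rcons ltnS.
move: (uw) zw; rewrite rcons_uniq mem_rcons inE => /andP[yp up].
case: (eqVneq z y) => [->|zy] /= zp.
  by rewrite (negbTE yp) andFb adj_irr.
rewrite zp andbC /=; case: (adj _ _ _); rewrite ?andbF // !andbT /=.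
have ip : (index z p < size p)%N by rewrite index_mem.
rewrite -cats1 index_cat zp.
have hy : nth v (p ++ [:: y]) (size p) = y by rewrite nth_cat ltnn subnn.
rewrite -{1}hy.
rewrite nth_uniq ?size_cat ?addn1 ?cats1 //.
by rewrite ltn_neqAle ip andbT eq_sym.
Qed.

(** The two edges share the repeated vertex and differ at the other end, so the order compares them
    strictly: a cycle-closing leaf outside [L] is either frozen to [sq] or coupled. *)
Lemma cycle_closing_edges u : cycle_closing u ->
  [/\ beginning_edge v u \in edges G, closing_edge v u \in edges G
    & beginning_edge v u != closing_edge v u].
Proof.
case/lastP: u => [//|w z] cc.
have /and3P[sw _ ci] := cc; rewrite parent_rcons in sw.
have zw : z \in w.
  apply: contraTT ci => zw; rewrite /cycle_start endv_rcons -cats1 index_cat.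
  by rewrite (negbTE zw) /= eqxx addn0 size_cat addn1 ltnS ltnNge leqW.
move: cc; rewrite cycle_closing_rcons // => /and3P[zpw az nz].
rewrite beginning_edge_rcons // closing_edge_rcons; split.
- apply: edge_set2; rewrite -{1}(nth_index v zw); apply: saw_adj => //.
  case/lastP: (w) zpw => // p y; rewrite parent_rcons -cats1 index_cat => zp.
  by rewrite zp size_cat addn1 ltnS index_mem.
- exact: edge_set2.
- by apply: contra nz; rewrite [X in _ == X]setUC => /eqP/set2_inj->.
Qed.

Lemma cd_node_rcons_in w z : saw w -> all (fun x => x \notin L) w -> z \in w ->
  cd_node (rcons w z) =
    [&& z \in parent w, adj G (endv w) z & endv w != next_vertex w z].
Proof.
move=> sw wL zw; rewrite /Defs.cd_node parent_rcons wL andbT.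
rewrite cycle_closing_rcons // saw_rcons; last by case: (w) zw.
by rewrite zw !andbF.
Qed.

Lemma cd_node_rcons_notin w x : saw w -> all (fun x => x \notin L) w ->
  x \notin w -> cd_node (rcons w x) = adj G (endv w) x.
Proof.
move=> sw wL xw; rewrite /Defs.cd_node parent_rcons wL andbT.
rewrite saw_rcons; last by case: (w) sw.
rewrite sw xw andbT /=; apply/orb_idr; case/and3P => _.
by rewrite parent_rcons endv_rcons.
Qed.

(** * Leaf spins and potentials once the first [m] walk vertices have their spins [t] *)

Definition boundary_upto m t : assignment X V := fun u =>
  if endv u \in L then Some (sL (endv u))
  else if cycle_closing u then
    if edge_lt (beginning_edge v u) (closing_edge v u) then Some sq
    else if (cycle_start u < m)%N then Some (t (endv u)) else None
  else None.

(** [boundary_upto] locates top endpoints by their position in [u]; these positions carry the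
    vertices of [w] only for [u] below [w]. *)
Definition boundary_below w m t eta :=
  forall u, cd_node u -> take (size w) u = w -> eta u = boundary_upto m t u.

Definition update t y s : V -> X := fun z => if z == y then s else t z.

(** Below the walk, the leaves coupled to it are those with cycle start [size p]. Leaves frozen
    earlier keep their spins, as [y] is not in [p]. *)
Lemma freeze_boundary eta p y t s : uniq (rcons p y) ->
  boundary_below (rcons p y) (size p) t eta ->
  boundary_below (rcons p y) (size p).+1 (update t y s)
    (freeze eta (rcons p y) s).
Proof.
move=> un bb u nu tu; rewrite /Defs.freeze bb // /boundary_upto /coupled nu /=.
case uL: (endv u \in L); rewrite /= ?andbF //.
case cc: (cycle_closing u) => //=.
have [eb ec ne] := cycle_closing_edges cc.
case lt_bc: (edge_lt (beginning_edge v u) _).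
  by rewrite (edge_lt_asym eb ec lt_bc).
have := edge_lt_total eb ec ne; rewrite lt_bc /= => -> /=.
have csu : (cycle_start u < size u)%N.
  by case/and3P: cc => _ _; apply: leq_trans; rewrite -addn3 leq_addr.
have nthu : nth v u (cycle_start u) = endv u.
  by rewrite nth_index //; rewrite -index_mem.
have size_w : size (rcons p y) = (size p).+1 by rewrite size_rcons.
rewrite /ancestor; case: eqP => [anc|nanc].
  have : size (take (cycle_start u).+1 u) = (size p).+1 by rewrite anc.
  rewrite size_takel // => -[csp].
  rewrite csp ltnSn /update -nthu csp -(nth_take v (ltnSn _)) -size_w tu.
  by rewrite nth_rcons ltnn eqxx eqxx.
have csp : cycle_start u <> size p.
  by move=> e; apply: nanc; rewrite e -size_w.
have -> : (cycle_start u < (size p).+1)%N = (cycle_start u < size p)%N.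
  by rewrite ltnS [RHS]ltn_neqAle; move/eqP: csp => ->.
case: ifP => // lt_csp; rewrite /update -nthu.
rewrite -(nth_take v (leqW lt_csp)) -size_w tu.
rewrite nth_rcons lt_csp; case: eqP => // e.
by move: un; rewrite rcons_uniq -e mem_nth.
Qed.

Lemma boundary_below_rcons eta w x m t :
  boundary_below w m t eta -> boundary_below (rcons w x) m t eta.
Proof.
move=> bb u nu tu; apply: bb => //.
have := congr1 (take (size w)) tu.
by rewrite -take_min size_rcons (minn_idPl (leqnSn _)) -cats1 take_size_cat.
Qed.

(** The edge by which the walk leaves [z] fixes a stage of the telescoping at [z]: copies on later
    edges still have [sq], those on earlier edges already have [t z]. *)
Definition copy_spin w t z y : X :=
  if edge_lt [set z; next_vertex w z] [set y; z] then sq else t z.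

Definition local_field y a : R := pot G y a * ((y \in L) ==> (a == sL y))%:R.

(* The potential at [y] once the vertices of [parent w] are deleted with spins
   [t].  The last edge of the walk carries no leaf, as the tree sum over it is
   taken at the parent; this is the reason for [y != next_vertex w z]. *)
Definition walk_field w t y a : R :=
  local_field y a *
  \prod_(z | (z \in parent w) && (adj G z y && (y != next_vertex w z)))
     inter G z y (copy_spin w t z y) a.

(** Moving on to [x] only adds the copies of [y]; the successors of older walk vertices are
    unchanged. *)
Lemma walk_field_rcons p y x t s z a : uniq (rcons p y) ->
  walk_field (rcons (rcons p y) x) (update t y s) z a =
    walk_field (rcons p y) t z a *
    (if adj G y z && (z != x)
     then inter G y z (if edge_lt [set y; x] [set z; y] then sq else s) a
     else 1).
Proof.
rewrite rcons_uniq => /andP[yp _]; rewrite /walk_field !parent_rcons -mulrA.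
congr (_ * _); rewrite big_mkcond (bigD1 y) //= mulrC [X in _ = X * _]big_mkcond.
rewrite [X in _ = X * _](bigD1 y) //= (negbTE yp) mul1r mem_rcons inE eqxx /=.
rewrite /copy_spin next_vertex_last // /update eqxx; congr (_ * _).
apply: eq_bigr => z' z'y; rewrite mem_rcons inE (negbTE z'y) /=.
case z'p: (z' \in p) => //=.
by rewrite next_vertex_rcons // parent_rcons.
Qed.

(** * Induction along the tree *)

Lemma ratio_defined_free eta w s : eta w = None -> ratio_defined eta w s ->
  [/\ pot G (endv w) sq != 0,
      forall x, cd_node (rcons w x) -> child_sum eta w s x sq != 0
    & forall x, cd_node (rcons w x) ->
        forall l, ratio_defined (freeze eta w s) (rcons w x) l].
Proof. by move=> /[swap]; case=> // ? ? ? ? ->. Qed.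

(** The coupling line of such a leaf, if any, starts at a proper ancestor of [w], whose spin is
    already fixed; so one term of the sum survives. *)
Lemma child_sum_closing eta p y t s z a : let w := rcons p y in
  saw w -> all (fun x => x \notin L) w ->
  boundary_below w (size p) t eta -> z \in w -> cd_node (rcons w z) ->
  child_sum eta w s z a = inter G z y (copy_spin w t z y) a.
Proof.
move=> w sw wL bb zw nz.
have := nz; rewrite cd_node_rcons_in // parent_rcons endv_rcons.
case/and3P=> zp ayz ynz.
have zpw : z \in parent w by rewrite parent_rcons.
have zL : (z \in L) = false by apply/negbTE/(allP wL).
have uw := saw_uniq sw.
have frz : freeze eta w s (rcons w z) = Some (copy_spin w t z y).
  rewrite (freeze_boundary s uw bb) //; last by rewrite -(cats1 w) take_size_cat.
  rewrite /boundary_upto endv_rcons zL cycle_closing_rcons // zpw endv_rcons.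
  rewrite ayz ynz /= beginning_edge_rcons // closing_edge_rcons endv_rcons.
  rewrite /copy_spin; case: ifP => // _; rewrite cycle_start_rcons //.
  rewrite -{1}(size_rcons p y) index_mem zw /update; case: eqP => // zy.
  by move: uw; rewrite rcons_uniq -zy zp.
rewrite /Defs.child_sum (bigD1 (copy_spin w t z y)) //= big1 => [|l ne].
  by rewrite (tree_ratio_frozen _ _ _ _ _ _ frz) eqxx mulr1 addr0 endv_rcons
    inter_sym.
by rewrite (tree_ratio_frozen _ _ _ _ _ _ frz) (negbTE ne) mulr0.
Qed.

(* The edges from [y] to the neighbours [x] off the walk are moved one at a
   time, in edge order, from the spin [sq] to the spin [s]: [x] changes the
   pinned sum by the factor [child_sum _ s / child_sum _ sq], since the
   coupling lines give [s] to the copies of [y] before [x] and [sq] to those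
   after [x]. *)
Lemma field_sum_telescope eta p y t s : let w := rcons p y in
  saw w -> all (fun x => x \notin L) w ->
  (forall x, x \notin w -> adj G y x -> child_sum eta w s x sq != 0) ->
  (forall x, x \notin w -> adj G y x -> exists c, forall l,
     pinned_sum G [set z in w] (walk_field (rcons w x) (update t y s)) x l =
     c * tree_ratio (freeze eta w s) (rcons w x) l) ->
  field_sum G [set z in w] (couple G (walk_field w t) y (fun=> s)) =
  field_sum G [set z in w] (couple G (walk_field w t) y (fun=> sq)) *
  \prod_(x | (x \notin w) && adj G y x)
     (child_sum eta w s x s / child_sum eta w s x sq).
Proof.
move=> w sw wL den_neq0 IH; have uw := saw_uniq sw.
pose N := [pred x | (x \notin w) && adj G y x].
pose leN x1 x2 := le [set y; x1] [set y; x2].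
pose r := sort leN (enum N).
pose b (r1 : seq V) z := if z \in r1 then s else sq.
pose H r1 := field_sum G [set z in w] (couple G (walk_field w t) y (b r1)).
have [le_anti le_trans le_total] := le_order.
have Nedge x : x \in N -> [set y; x] \in edges G.
  by case/andP=> _; apply: edge_set2.
have mem_r x : (x \in r) = (x \in N) by rewrite mem_sort mem_enum.
have allN : all (mem N) (enum N) by apply/allP => x; rewrite mem_enum.
have pair_r : pairwise leN r.
  have tr : {in N & &, transitive leN}.
    by move=> x1 x2 x3 N1 N2 N3; apply: le_trans; apply: Nedge.
  have tot : {in N &, total leN}.
    by move=> x1 x2 N1 N2; apply: le_total; apply: Nedge.
  rewrite -(sorted_pairwise_in tr) ?(sort_sorted_in tot) //.
  by apply/allP => x; rewrite mem_r.
have uniq_r : uniq r by rewrite sort_uniq enum_uniq.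
have -> : field_sum G [set z in w] (couple G (walk_field w t) y (fun=> s)) = H r.
  apply: eq_field_sum => z; rewrite inE => zw a; rewrite /couple /b mem_r inE zw /=.
  by case: (adj G y z).
rewrite (telescope_seq (q := fun x =>
  child_sum eta w s x s / child_sum eta w s x sq)) => [|r1 x r2 er].
  congr (_ * _); rewrite (perm_big (enum N)) ?perm_sort //= big_enum_cond /=.
  by apply: eq_bigl => x; rewrite andbT.
have : x \in r by rewrite er mem_cat inE eqxx orbT.
rewrite mem_r => Nx; have /andP[xw ayx] := Nx.
have [c Ec] := IH x xw ayx.
move: uniq_r pair_r; rewrite er cat_uniq pairwise_cat /=
  => /and3P[_ disj /andP[xr2 _]].
case/and3P=> le12 _ /andP[lex2 _].
have xr1 : x \notin r1 by apply: contra disj => xr1; rewrite xr1.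
(* As [r] is sorted, [r1] holds exactly the neighbours before [x], so stage [r1] matches [copy_spin]
   for the walk continued to [x]. *)
have lt_r1 z : z \notin w -> z != x -> adj G y z ->
    edge_lt [set y; x] [set z; y] = (z \notin r1).
  move=> zw zx ayz; rewrite [[set z; y]]setUC.
  have zN : z \in N by apply/andP.
  have nzx : [set y; x] != [set y; z].
    by apply: contra zx => /eqP/set2_inj->.
  case zr1: (z \in r1) => /=.
    apply: edge_lt_asym; rewrite ?Nedge // /Defs.edge_lt eq_sym nzx /=.
    by apply: (allrelP le12); rewrite ?inE ?eqxx.
  rewrite /Defs.edge_lt nzx; apply: (allP lex2).
  by move: zN; rewrite -mem_r er mem_cat zr1 inE (negbTE zx).
(* One constant [c] serves both stages: they differ only on the edge from [y] to [x], which
   [walk_field] omits and [child_sum] supplies. *)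
have HE b' : (forall z, z != x -> b' z = b r1 z) ->
    field_sum G [set z in w] (couple G (walk_field w t) y b') =
    c * child_sum eta w s x (b' x).
  move=> eb; rewrite (field_sum_pinned _ _ _ x) /Defs.child_sum big_distrr /=.
  apply: eq_bigr => l _; rewrite endv_rcons mulrCA -Ec.
  apply: (@pinned_sum_factor _ _ _ _ _ _ _ _ (inter G y x (b' x))).
  - by rewrite inE.
  - move=> z; rewrite inE => zw zx a; rewrite walk_field_rcons // /couple zx andbT.
    case ayz: (adj G y z) => //; rewrite eb // lt_r1 //.
    by rewrite /b; case: (z \in r1).
  - move=> a; rewrite walk_field_rcons // /couple eqxx andbF mulr1 ayx.
    exact: mulrC.
rewrite /H (HE (b (rcons r1 x))) => [|z zx]; last first.
  by rewrite /b mem_rcons inE (negbTE zx).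
rewrite (HE (b r1)) // /b mem_rcons inE eqxx (negbTE xr1) /=.
by rewrite -mulrA; congr (_ * _); rewrite mulrCA mulfV ?mulr1 // den_neq0.
Qed.

Lemma pinned_sum_tree_ratio n eta w t : (#|V|.+1 - size w <= n)%N -> saw w ->
  all (fun x => x \notin L) (parent w) ->
  boundary_below w (size w).-1 t eta ->
  forall l, ratio_defined eta w l ->
    pinned_sum G [set z in parent w] (walk_field w t) (endv w) l =
    pinned_sum G [set z in parent w] (walk_field w t) (endv w)
      (odflt sq (eta w)) * tree_ratio eta w l.
Proof.
elim: n eta w t => [|n IH] eta w t.
  by rewrite leqn0 subn_eq0 => /leq_trans h /saw_size/h; rewrite ltnn.
case/lastP: w => // p y hn sw pL; set w := rcons p y in hn sw *.
rewrite /w size_rcons /= -/w => bb.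
have uw := saw_uniq sw; have := uw; rewrite rcons_uniq => /andP[yp up].
rewrite !parent_rcons endv_rcons in pL *.
have nw : cd_node w by rewrite /Defs.cd_node sw parent_rcons.
have := bb w nw (take_size w); rewrite /boundary_upto saw_not_cycle_closing //.
rewrite endv_rcons; case: ifP => yL etaw.
  move=> l _; rewrite etaw (tree_ratio_frozen _ _ _ _ _ _ etaw).
  case: (eqVneq l (sL y)) => [->|ly]; first by rewrite mulr1.
  rewrite mulr0 pinned_sum_couple ?inE //.
  by rewrite {1}/walk_field /local_field yL (negbTE ly) !(mulr0, mul0r).
have wL : all (fun x => x \notin L) w by rewrite all_rcons yL.
have setw : y |: [set z in p] = [set z in w].
  by apply/setP => z; rewrite !inE mem_rcons inE.
move=> s /(ratio_defined_free etaw)[]; rewrite endv_rcons => pot0 den0 def.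
rewrite etaw !pinned_sum_couple ?inE // setw.
rewrite (@field_sum_telescope eta p y t s) //; last first.
- move=> x xw ayx; have nx : cd_node (rcons w x).
    by rewrite cd_node_rcons_notin // endv_rcons.
  have /IH bound : (#|V|.+1 - size (rcons w x) <= n)%N.
    by rewrite size_rcons subSS -ltnS -subSn // (saw_size sw).
  move/(_ (freeze eta w s) (update t y s)): bound.
  rewrite parent_rcons endv_rcons size_rcons => bound.
  eexists => l; apply: bound (def _ nx l) => //.
    by rewrite saw_rcons -?size_eq0 ?size_rcons // sw endv_rcons ayx.
  by rewrite size_rcons; apply/boundary_below_rcons/freeze_boundary.
- by move=> x xw ayx; apply: den0; rewrite cd_node_rcons_notin // endv_rcons.
(* Children off the walk give the telescoping product; those on it are cycle-closing leaves and give
   the factors of [walk_field] at [y]. *)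
rewrite tree_ratioE // endv_rcons [in RHS](bigID (mem w)) /=.
rewrite [X in _ = _ * (_ * (_ * X))](eq_bigl (fun x =>
  (x \notin w) && adj G y x)) => [|x]; last first.
  rewrite andbC; case xw: (x \in w) => //=.
  by rewrite cd_node_rcons_notin ?xw // endv_rcons.
have closeE x : cd_node (rcons w x) && (x \in w) =
    (x \in parent w) && (adj G x y && (y != next_vertex w x)).
  rewrite andbC; case xw: (x \in w) => /=.
    by rewrite cd_node_rcons_in // endv_rcons adj_sym.
  apply/esym/negbTE; apply: contraFN xw => /andP[]; rewrite parent_rcons.
  by rewrite mem_rcons inE => ->; rewrite orbT.
rewrite [X in _ = _ * (_ * (X * _))](eq_bigr (fun z =>
    inter G z y (copy_spin w t z y) s / inter G z y (copy_spin w t z y) sq)).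
  2: by move=> z /andP[nz zw]; rewrite !(child_sum_closing _ _ sw wL bb).
rewrite (eq_bigl _ _ closeE) [X in _ = _ * (_ * (X * _))]prodf_div.
rewrite /walk_field /local_field yL /= !mulr1.
set A := \prod_(z | _) inter G z y _ s; set B := \prod_(z | _) inter G z y _ sq.
(* [B] is a product of denominators of the recursion, nonzero because the ratio is defined. *)
have B0 : B != 0.
  apply/prodf_neq0 => z; rewrite -closeE => /andP[nz zw].
  by rewrite -(child_sum_closing s _ sw wL bb) // den0.
set H := field_sum _ _ _; set Q := \prod_(x | _) _.
suff -> : pot G y s * A = pot G y sq * B * (pot G y s / pot G y sq * (A / B)).
  by ring.
by field; rewrite pot0 B0.
Qed.

(** * The root and normalisation *)

Lemma prod_local_field (x : {ffun V -> X}) :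
  \prod_y local_field y (x y) =
  if agrees L sL x then \prod_y pot G y (x y) else 0.
Proof.
case: ifP => [/forallP ag|/negbT/forallPn[y]].
  by apply: eq_bigr => y _; rewrite /local_field ag mulr1.
by move=> /negbTE nag; rewrite (bigD1 y) //= /local_field nag mulr0 mul0r.
Qed.

Lemma pinned_sum_root t a :
  pinned_sum G [set z in parent [:: v]] (walk_field [:: v] t) v a =
  \sum_(x : {ffun V -> X} | agrees L sL x && (x v == a)) weight G x.
Proof.
rewrite big_mkcondl; apply: eq_bigr => x _.
rewrite /field_weight (eq_bigl xpredT) => [|y]; last by rewrite inE.
rewrite (eq_bigr (fun y => local_field y (x y))) => [|y _]; last first.
  by rewrite /walk_field big_pred0 ?mulr1.
rewrite prod_local_field; case: ifP => _; last by rewrite mulr0.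
by congr (_ * _); apply: eq_bigl => p; rewrite !inE !andbT.
Qed.

End CDTreeRatio.

Theorem theorem2p6 (R : realFieldType) (X V : finType) (sq : X)
    (G : spin_system R X V)
    (le : rel {set V}) (le_order : edge_order G le)
    (L : {set V}) (sL : V -> X) (v : V)
    (feasible : partition_function G L sL != 0) :
  (forall s : X,
     marginal G L sL v sq != 0 ->
     cd_ratio_defined sq G le L sL v s ->
     graph_ratio G sq L sL v s = cd_ratio sq G le L sL v s) /\
  ((forall s : X, cd_ratio_defined sq G le L sL v s) ->
   forall s : X,
     marginal G L sL v s =
       cd_ratio sq G le L sL v s / \sum_(l : X) cd_ratio sq G le L sL v l).
Proof.
pose Z a := \sum_(x : {ffun V -> X} | agrees L sL x && (x v == a)) weight G x.
pose s0 := odflt sq (cd_boundary sq G le L sL v [:: v]).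
have ZR s : cd_ratio_defined sq G le L sL v s ->
    Z s = Z s0 * cd_ratio sq G le L sL v s.
  rewrite /Z -!(pinned_sum_root sq G le L sL v (fun=> sq)).
  apply: (pinned_sum_tree_ratio le_order (leqnn _)) => //.
    by rewrite /saw /= eqxx.
  move=> u _ _; rewrite /boundary_upto /cd_boundary ltn0.
  by case: ifP => // _; case: cycle_closing => //=; case: ifP.
have ZE : partition_function G L sL = \sum_a Z a.
  by rewrite /partition_function
    (partition_big (fun x : {ffun V -> X} => x v) predT).
split=> [s nsq ds|ds s].
  have Zsq : Z sq != 0.
    by apply: contra nsq => /eqP e; rewrite /marginal -/(Z sq) e mul0r.
  (* A root frozen to another spin would have ratio 0 at [sq], forcing [Z sq] to vanish. *)
  have s0E : s0 = sq.
    rewrite /s0; case e: (cd_boundary _ _ _ _ _ _ _) => [t|] //=.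
    apply/eqP; apply: contraR Zsq => /negbTE nt.
    rewrite (ZR sq); last exact: RatioFrozen e.
    by rewrite /cd_ratio (tree_ratio_frozen _ _ _ _ _ _ e) [sq == t]eq_sym nt mulr0.
  rewrite /graph_ratio /marginal -/(Z s) -/(Z sq) invf_div mulrA divfK //.
  by rewrite (ZR s) // s0E mulrC mulKf.
(* The common factor [Z s0] divides the nonzero partition function, so it cancels in the
   marginal. *)
have cE : partition_function G L sL = Z s0 * \sum_l cd_ratio sq G le L sL v l.
  by rewrite ZE big_distrr; apply: eq_bigr => l _; apply: ZR.
have c0 : Z s0 != 0 by apply: contra feasible => /eqP c0; rewrite cE c0 mul0r.
by rewrite /marginal -/(Z s) cE ZR // -mulf_div divff // mul1r.
Qed.
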